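(* Suppose that for every pair of consecutive primes $p_{n-1}<p_n$ such that $p_n$ is a Legendre prime, the inequality $p_n-p_{n-1}<2\sqrt{p_n}+1$ holds. Then for every integer $n\ge 2$ there is a prime $p$ with $(n-1)^2<p<n^2$.
   Context: $p_1=2,p_2=3,\dots$ denotes the sequence of primes in increasing order. A prime $p$ is called a Legendre prime if there is an integer $a\ge1$ such that $p$ is the smallest prime greater than $a^2$ (i.e. $p_{n-1}<a^2<p_n=p$); the Legendre primes are $2,5,11,17,29,37,53,\dots$. *)

(* Defs.v *)
From mathcomp Require Import all_boot all_order all_algebra.
From mathcomp Require Import reals.

Set Implicit Arguments.
Unset Strict Implicit.
Unset Printing Implicit Defensive.

Lemma exists_prime_gt (m : nat) : exists p, (m < p) && prime p.
Proof. by have [p lt_mp pr_p] := prime_above m; exists p; rewrite lt_mp. Qed.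

Definition next_prime (m : nat) : nat := ex_minn (exists_prime_gt m).

(* Indexed from 1: nth_prime 1 = 2, nth_prime 2 = 3, nth_prime 3 = 5, ...
   The value nth_prime 0 = 0 is only the seed of the iteration. *)
Definition nth_prime (n : nat) : nat := iter n next_prime 0.

Lemma next_primeP (m : nat) :
  [/\ prime (next_prime m), m < next_prime m
    & forall q, prime q -> m < q -> next_prime m <= q].
Proof.
rewrite /next_prime; case: ex_minnP => p /andP[lt_mp pr_p] min_p; split=> //.
by move=> q pr_q lt_mq; apply: min_p; rewrite lt_mq.
Qed.

Lemma nth_prime1 : nth_prime 1 = 2.
Proof.
have [pr_p _ min_p] := next_primeP 0.
by apply/eqP; rewrite eqn_leq min_p //= prime_gt1.
Qed.

Lemma prime_nth_prime (n : nat) : 0 < n -> prime (nth_prime n).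
Proof. by case: n => // n _; have [] := next_primeP (nth_prime n). Qed.

Lemma nth_prime_ltS (n : nat) : nth_prime n < nth_prime n.+1.
Proof. by have [] := next_primeP (nth_prime n). Qed.

Lemma nth_prime_onto (p : nat) :
  prime p -> exists2 n, 0 < n & nth_prime n = p.
Proof.
move=> pr_p; have le_id n : n <= nth_prime n.
  by elim: n => // n IHn; apply: leq_ltn_trans IHn (nth_prime_ltS n).
have ex_n : exists n, p <= nth_prime n by exists p.
case: (ex_minnP ex_n) => [[|n] le_pn min_n].
  by move: le_pn; rewrite leqNgt prime_gt0.
exists n.+1 => //; apply/eqP; rewrite eqn_leq le_pn andbT.
have [_ _ min_p] := next_primeP (nth_prime n); apply: min_p => //.
by rewrite ltnNge; apply/negP => /min_n; rewrite ltnn.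
Qed.

Definition legendre_prime (p : nat) : Prop :=
  exists a : nat,
    [/\ 1 <= a, prime p, a ^ 2 < p
      & forall q, prime q -> a ^ 2 < q -> p <= q].

(* Main.v *)
(* If no prime lies between a^2 and (a+1)^2, then the least prime p above a^2
   is a Legendre prime with p > (a+1)^2, and its predecessor q satisfies
   q < a^2. For a >= 3 also q <> a^2 - 1 = (a-1)(a+1), so q <= a^2 - 2.
   This one extra unit is what makes p - q >= 2 sqrt p + 1: writing
   p = (a+1)^2 + k with k >= 1 gives p - q - 1 >= 2(a+1) + k, whose square
   exceeds 4p = 4(a+1)^2 + 4k. *)
Require Import Defs.
From mathcomp Require Import all_boot all_order all_algebra.
From mathcomp Require Import reals.
From mathcomp Require Import zify.

Import Order.TTheory GRing.Theory Num.Theory.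

Lemma prime_mulF (x y : nat) : 1 < x -> 1 < y -> prime (x * y) = false.
Proof.
move=> lt1x lt1y; apply/negP => pr_xy.
have /prime_nt_dvdP -/(_ pr_xy) : x %| x * y by exact: dvdn_mulr.
by move/(_ _)/eqP; nia.
Qed.

(** Since [q < p], the truncated [p - q - 1] agrees with the real difference and is nonnegative, so
    both sides can be squared to remove the root. *)
Lemma sqr_lt_of_sqrt_gap (R : rcfType) (p q : nat) : q < p ->
  (p%:R - q%:R < 2 * Num.sqrt p%:R + 1 :> R)%R -> (p - q - 1) ^ 2 < 4 * p.
Proof.
move=> lt_qp; rewrite -ltrBlDr.
rewrite -(natrB R (ltnW lt_qp)) -(@natrB R _ 1) ?subn_gt0 // => gap.
rewrite -(ltr_nat R) natrX natrM -[X in (_ < _ * X)%R]sqr_sqrtr ?ler0n //.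
by rewrite (natrM R 2 2) -expr2 -exprMn ltrXn2r // ?ler0n // mulr_ge0 ?sqrtr_ge0.
Qed.

Theorem theorem18 (R : realType)
  (gap : forall n : nat, 2 <= n -> legendre_prime (nth_prime n) ->
    ((nth_prime n)%:R - (nth_prime n.-1)%:R
       < 2 * Num.sqrt (nth_prime n)%:R + 1 :> R)%R) :
  forall n : nat, 2 <= n ->
    exists p : nat, prime p /\ (n - 1) ^ 2 < p < n ^ 2.
Proof.
(* With [a = n - 1], the cases [a = 1, 2] go by hand: [a ^ 2 - 1] is composite only from [a = 3]
   on. *)
case=> [|[|[|[|m]]]] // _; [by exists 2 | by exists 5 |].
rewrite subn1 /=; set a := m.+3.
have [pr_p lt_ap min_p] := next_primeP (a ^ 2).
have [lt_p|le_p] := ltnP (next_prime (a ^ 2)) (a.+1 ^ 2).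
  by exists (next_prime (a ^ 2)); rewrite lt_ap.
exfalso; have [k k_gt0 def_p] := nth_prime_onto pr_p.
rewrite -def_p in pr_p lt_ap min_p le_p.
(* This makes the predecessor [nth_prime k.-1] a true prime rather than the seed 0. *)
have k_gt1 : 1 < k.
  case: k k_gt0 def_p lt_ap {pr_p min_p le_p} => [|[|k]] //.
  by rewrite nth_prime1; nia.
have lt_qp : nth_prime k.-1 < nth_prime k.
  by rewrite -[X in _ < nth_prime X](prednK k_gt0) nth_prime_ltS.
have pr_q : prime (nth_prime k.-1) by apply: prime_nth_prime; lia.
have le_qa : nth_prime k.-1 <= a ^ 2.
  by rewrite leqNgt; apply/negP => /(min_p _ pr_q); rewrite leqNgt lt_qp.
have leg_p : legendre_prime (nth_prime k) by exists a.
have := @sqr_lt_of_sqrt_gap R _ _ lt_qp (gap k k_gt1 leg_p).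
have neq_p : nth_prime k <> a.+1 ^ 2.
  by move=> eq_p; rewrite eq_p expnS expn1 prime_mulF in pr_p.
have neq_qa : nth_prime k.-1 <> a ^ 2.
  by move=> eq_q; rewrite eq_q expnS expn1 prime_mulF in pr_q.
(* The product is [a ^ 2 - 1], as [m.+2] is [a - 1]. *)
have neq_qa1 : nth_prime k.-1 <> m.+2 * a.+1.
  by move=> eq_q; rewrite eq_q prime_mulF in pr_q.
move: (nth_prime k) (nth_prime k.-1) le_p neq_p le_qa neq_qa neq_qa1
  {pr_p lt_ap min_p leg_p def_p lt_qp pr_q} => p q.
rewrite /a => le_p neq_p le_qa neq_qa neq_qa1.
have le_qa2 : q + 2 <= m.+3 ^ 2 by nia.
have [j def_p] : exists j, p = m.+4 ^ 2 + j.+1.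
  by exists (p - m.+4 ^ 2).-1; lia.
have le_gap : 2 * m.+4 + j.+1 <= p - q - 1 by nia.
(* In the square of the lower bound, the cross term [4 * m.+4 * j.+1] already exceeds [4 * j.+1]. *)
by move: le_gap; rewrite def_p; set d := (_ - q - 1); nia.
Qed.
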